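(* Let $G$ be a countable abelian group and let $(X,\mu)$ be a (not necessarily ergodic) $G$-space. For every $A\subset G$ and every measurable set $B\subset X$ of positive $\mu$-measure, $$c(A^k,B)\le\Big(\frac{\mu(AB)}{\mu(B)}\Big)^k$$ for all integers $k\ge1$.
   Context: A $G$-space $(X,\mu)$ is a probability measure space such that $L^2(X,\mu)$ is separable, on which $G$ acts by bi-measurable bijections preserving $\mu$. For $A\subset G$ and $B\subset X$, $AB=\bigcup_{a\in A}aB$. $A^k$ denotes the $k$-fold product set of $A$ with itself. For $A\subset G$ and measurable $B\subset X$ with $\mu(B)>0$, $$c(A,B)=\inf\Big\{\frac{\mu(AB')}{\mu(B')} : B'\subset B \text{ measurable},\ \mu(B')>0\Big\}.$$ *)

(* Defs.v *)
From HB Require Import structures.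
From mathcomp Require Import all_boot all_order all_algebra.
From mathcomp Require Import all_classical all_reals all_analysis.

Set Implicit Arguments.
Unset Strict Implicit.
Unset Printing Implicit Defensive.

Import Order.TTheory GRing.Theory Num.Theory.
Import numFieldNormedType.Exports.

Local Open Scope classical_set_scope.
Local Open Scope ring_scope.
Local Open Scope ereal_scope.

(* [LspaceType2 mu] is the real Hilbert space L^2(X, mu) of a.e.-classes; its
   separability is equivalent to that of the complex L^2 space. *)
Definition L2_separable (d : measure_display) (X : measurableType d)
    (R : realType) (mu : {measure set X -> \bar R}) : Prop :=
  exists2 D : set (LspaceType2 mu), countable D &
    forall (f : LspaceType2 mu) (e : R), (0 < e)%R ->
      exists2 h : LspaceType2 mu, D h &
        'N[mu]_2%:E[EFin \o (f \- h)%R] < e%:E.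

(* No separate clause is needed for [act g] being a bijection with measurable
   inverse: by the first two clauses its inverse is [act g^-1], which is
   measurable by the third. *)
Record is_Gspace (G : groupType) (d : measure_display) (X : measurableType d)
    (R : realType) (mu : probability X R) (act : G -> X -> X) : Prop := {
  Gspace_act1 : forall x, act 1%g x = x;
  Gspace_actM : forall g h x, act (g * h)%g x = act g (act h x);
  Gspace_measurable : forall g, measurable_fun [set: X] (act g);
  Gspace_preserving : forall g (B : set X), measurable B ->
    mu (act g @^-1` B) = mu B;
  Gspace_separable : L2_separable mu
}.

Definition set_prod (G : groupType) (A B : set G) : set G :=
  [set (a * b)%g | a in A & b in B].

Definition set_pow (G : groupType) (A : set G) (k : nat) : set G :=
  iterop k (@set_prod G) A [set 1%g].

Definition act_set (G : groupType) (X : Type) (act : G -> X -> X)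
    (A : set G) (B : set X) : set X :=
  \bigcup_(a in A) (act a @` B).

(* c(A, B) *)
Definition magnification (G : groupType) (d : measure_display)
    (X : measurableType d) (R : realType) (mu : probability X R)
    (act : G -> X -> X) (A : set G) (B : set X) : \bar R :=
  ereal_inf [set mu (act_set act A B') / mu B' | B' in
    [set B' : set X | [/\ measurable B', B' `<=` B & 0 < mu B']]].

(* Main.v *)
Require Import Defs.
From HB Require Import structures.
From mathcomp Require Import all_boot all_order all_algebra.
From mathcomp Require Import all_classical all_reals all_analysis.
From mathcomp Require Import lra.

Import Order.TTheory GRing.Theory Num.Theory.
Import numFieldNormedType.Exports.

Local Open Scope classical_set_scope.
Local Open Scope ereal_scope.

(** Write [K] for the ratio mu(AB)/mu(B) and consider the functional
    phi(S) = mu(AS) - K mu(S) on measurable sets.  The map S |-> AS preserves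
    unions and satisfies A(S cap T) <= AS cap AT, so phi is submodular:
    phi(S cup T) + phi(S cap T) <= phi(S) + phi(T).  Moreover phi is continuous
    along increasing sequences and lower semicontinuous along decreasing ones,
    and, G being abelian, phi(gS) = phi(S).

    Submodularity and the two semicontinuity properties make phi attain its
    minimum over the measurable subsets of [B], even when [A] is infinite
    ([submodular_minimizer]): if [S n] is within 2^-n of the infimum, then
    limsup S n is a minimizer.  Since phi(B) = 0, either some subset of [B]
    makes phi negative, and then a minimizer has positive measure, or [B]
    itself is a minimizer.

    Let [S] be a minimizer of positive measure.  This is the point where
    Petridis' argument takes over ([excess_setU_translate]): for every [Y] and
    every g, the set Y cap gS is a translate of a subset of [S], so
    phi(Y cap gS) >= phi(S) = phi(gS), and submodularity gives
    phi(Y cup gS) <= phi(Y).  Adding the translates gS, g in F, one at a time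
    starting from the empty set, phi(FS) <= 0 for every F, that is
    mu(AFS) <= K mu(FS).  With F = 1, A, A^2, ... this yields
    mu(A^k S) <= K^k mu(S), which bounds c(A^k, B). *)

(** * Minimizing a submodular functional *)

Section Submodular.
Context {d : measure_display} {X : measurableType d} {R : realType}.
Local Open Scope ring_scope.

Definition submodular (F : set X -> R) := forall S T : set X,
  measurable S -> measurable T -> F (S `|` T) + F (S `&` T) <= F S + F T.

Definition lsc_increasing (F : set X -> R) := forall (S : (set X)^nat) (c : R),
  (forall n, measurable (S n)) -> {homo S : n m / (n <= m)%N >-> n `<=` m} ->
  (forall n, F (S n) <= c) -> F (\bigcup_n S n) <= c.

Definition lsc_decreasing (F : set X -> R) := forall (S : (set X)^nat) (c : R),
  (forall n, measurable (S n)) -> {homo S : n m / (n <= m)%N >-> m `<=` n} ->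
  (forall n, F (S n) <= c) -> F (\bigcap_n S n) <= c.

(** If two sets are within [a] and [b] of the minimal value, their union is
    within [a + b] of it, because the intersection cannot be below it.  Hence
    the finite unions of [S N], [S N.+1], ... stay within the sum of the errors,
    their increasing limit [T N] is within [2 * 2^-N], and the decreasing limit
    of the [T N] has the minimal value. *)
Lemma submodular_minimizer (F : set X -> R) (B : set X) (b : R) :
  measurable B -> (forall S, measurable S -> b <= F S) ->
  submodular F -> lsc_increasing F -> lsc_decreasing F ->
  exists S, [/\ measurable S, S `<=` B &
    forall S', measurable S' -> S' `<=` B -> F S <= F S'].
Proof.
move=> mB Fb Fsub Fup Fdown.
pose E := [set F S | S in [set S | measurable S /\ S `<=` B]].
have lE : has_lbound E by exists b => _ [S [mS _] <-]; exact: Fb.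
have infE : has_inf E by split => //; exists (F B), B => //; split.
pose infF := inf E.
have infF_le S : measurable S -> S `<=` B -> infF <= F S.
  by move=> mS SB; apply: ge_inf => //; exists S.
have /choice[S S_near] (n : nat) :
    exists S, [/\ measurable S, S `<=` B & F S <= infF + 2^-1 ^+ n].
  have e0 : 0 < 2^-1 ^+ n :> R by rewrite exprn_gt0.
  have [_ [S [mS SB] <-] /ltW FS] := inf_adherent e0 infE.
  by exists S.
pose U N j := \big[setU/set0]_(i < j.+1) S (N + i)%N.
have mU N j : measurable (U N j).
  by apply: bigsetU_measurable => i _; case: (S_near (N + i)%N).
have UB N j : U N j `<=` B.
  rewrite /U -(bigcup_mkord _ (fun i => S (N + i)%N)); apply: bigcup_sub => i _.
  by have [] := S_near (N + i)%N.
(* What is added to [infF] is the sum of the 2^-i for N <= i <= N + j. *)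
have FU N j : F (U N j) <= infF + 2 * 2^-1 ^+ N - 2^-1 ^+ (N + j).
  elim: j => [|j IHj].
    rewrite /U big_ord_recl big_ord0 setU0 addn0 /=.
    by have [_ _] := S_near (N + 0)%N; rewrite addn0; lra.
  have -> : U N j.+1 = U N j `|` S (N + j.+1)%N by rewrite /U big_ord_recr.
  have [mS SB FS] := S_near (N + j.+1)%N.
  have := Fsub _ _ (mU N j) mS.
  have : infF <= F (U N j `&` S (N + j.+1)%N).
    by apply: infF_le; [exact: measurableI | move=> x [_ /SB]].
  move: FS IHj; rewrite addnS exprS; lra.
pose T N := \bigcup_i S (N + i)%N.
have TU N : T N = \bigcup_j U N j by rewrite /T -bigcup_bigsetU_bigcup.
have mT N : measurable (T N) by rewrite TU; exact: bigcupT_measurable.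
have T_noninc : {homo T : n m / (n <= m)%N >-> m `<=` n}.
  move=> n m nm x [i _ Sx]; exists (m - n + i)%N => //.
  by rewrite addnA subnKC.
have FT N : F (T N) <= infF + 2 * 2^-1 ^+ N.
  rewrite TU; apply: (Fup (U N)) => // [n m nm|j].
    have := @subset_bigsetU _ (fun i => S (N + i)%N) n.+1 m.+1; exact.
  by apply: (le_trans (FU N j)); rewrite gerBl exprn_ge0.
exists (\bigcap_N T N); split.
- exact: bigcapT_measurable.
- by move=> x /(_ 0%N I)[i _]; case: (S_near (0 + i)%N) => _ + _; apply.
move=> S' mS' S'B; apply: le_trans (infF_le _ mS' S'B).
(* [T] being decreasing, its first [N] terms do not affect the intersection. *)
have FL N : F (\bigcap_N T N) <= infF + 2 * 2^-1 ^+ N.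
  have -> : \bigcap_N T N = \bigcap_n T (N + n)%N.
    apply/seteqP; split => x Tx n _; first exact: Tx.
    exact: (T_noninc _ _ (leq_addl N n)) (Tx n _).
  apply: Fdown => // [n m nm|n]; first by apply: T_noninc; rewrite leq_add2l.
  apply: (le_trans (FT _)); rewrite lerD2l ler_pM2l// ler_wiXn2l//.
  - by rewrite invf_le1// ler1n.
  - exact: leq_addr.
have cvg_infF : (fun N => infF + 2 * 2^-1 ^+ N) @ \oo --> infF.
  rewrite -[X in _ --> X]addr0; apply: cvgD; first exact: cvg_cst.
  by apply: cvg_geometric; rewrite ger0_norm ?invf_lt1// ?ltr1n.
by apply: (cvgr_to_ge cvg_infF); near=> N; exact: FL.
Unshelve. all: by end_near. Qed.

End Submodular.

(** * The real-valued measure *)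

Section RealMeasure.
Context {d : measure_display} {X : measurableType d} {R : realType}.
Variable mu : probability X R.
Local Open Scope ring_scope.

Definition real_measure (S : set X) : R := fine (mu S).
Local Notation m := real_measure.

Lemma real_measureE S : measurable S -> mu S = (m S)%:E.
Proof. by move=> mS; rewrite fineK// fin_num_measure. Qed.

Lemma real_measure0 : m set0 = 0.
Proof. by rewrite /m measure0. Qed.

Lemma real_measure_ge0 S : 0 <= m S.
Proof. exact/fine_ge0/measure_ge0. Qed.

Lemma real_measure_le1 S : measurable S -> m S <= 1.
Proof. by move=> mS; rewrite -lee_fin -(real_measureE _ mS) probability_le1. Qed.

Lemma le_real_measure S T :
  measurable S -> measurable T -> S `<=` T -> m S <= m T.
Proof.
move=> mS mT ST; rewrite fine_le ?fin_num_measure//.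
by apply: le_measure; rewrite ?inE.
Qed.

Lemma real_measureUI S T : measurable S -> measurable T ->
  m (S `|` T) + m (S `&` T) = m S + m T.
Proof.
move=> mS mT; have mST := measurableI _ _ mS mT.
have : (mu (S `|` T) = mu S + mu T - mu (S `&` T))%E.
  by apply: measureUfinl => //; rewrite -ge0_fin_numE ?fin_num_measure.
rewrite !real_measureE//; last exact: measurableU.
by move=> /(congr1 fine)/= ->; rewrite subrK.
Qed.

Lemma real_measure_cvg_increasing (S : (set X)^nat) :
  (forall n, measurable (S n)) -> {homo S : n m / (n <= m)%N >-> n `<=` m} ->
  m (S n) @[n --> \oo] --> m (\bigcup_n S n).
Proof.
move=> mS S_homo; apply: fine_cvg; rewrite -real_measureE; last exact: bigcupT_measurable.
apply: nondecreasing_cvg_mu => //; first exact: bigcupT_measurable.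
by move=> n p np; rewrite subsetEset; exact: S_homo.
Qed.

Lemma real_measure_cvg_decreasing (S : (set X)^nat) :
  (forall n, measurable (S n)) -> {homo S : n m / (n <= m)%N >-> m `<=` n} ->
  m (S n) @[n --> \oo] --> m (\bigcap_n S n).
Proof.
move=> mS S_homo; apply: fine_cvg; rewrite -real_measureE; last exact: bigcapT_measurable.
apply: nonincreasing_cvg_mu => //.
- by rewrite -ge0_fin_numE ?fin_num_measure.
- exact: bigcapT_measurable.
- by move=> n p np; rewrite subsetEset; exact: S_homo.
Qed.

End RealMeasure.

(** * Translates of sets *)

Section Translates.
Context {G : groupType} {d : measure_display} {X : measurableType d}.
Context {R : realType} {mu : probability X R} {act : G -> X -> X}.
Hypothesis XG : is_Gspace mu act.
Hypothesis G_countable : countable [set: G].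
Implicit Types (A F : set G) (S T : set X).

Lemma act_imageE g S : act g @` S = act g^-1%g @^-1` S.
Proof.
apply/seteqP; split => [_ [x Sx <-]|x Sx] /=.
  by rewrite -(Gspace_actM XG) mulVg (Gspace_act1 XG).
by exists (act g^-1%g x) => //; rewrite -(Gspace_actM XG) mulgV (Gspace_act1 XG).
Qed.

Lemma measurable_act_image g S : measurable S -> measurable (act g @` S).
Proof.
move=> mS; rewrite act_imageE -[_ @^-1` _]setTI.
exact: (Gspace_measurable XG).
Qed.

Lemma measure_act_image g S : measurable S -> mu (act g @` S) = mu S.
Proof. by move=> mS; rewrite act_imageE (Gspace_preserving XG). Qed.

Lemma measurable_act_set A S : measurable S -> measurable (act_set act A S).
Proof.
move=> mS; rewrite /act_set bigcup_mkcond.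
apply: countable_bigcupT_measurable => // a; case: ifPn => _ //.
exact: measurable_act_image.
Qed.

Lemma act_set0 A : act_set act A set0 = set0.
Proof. by rewrite /act_set bigcup0// => a _; rewrite image_set0. Qed.

Lemma act_setS A S T : S `<=` T -> act_set act A S `<=` act_set act A T.
Proof. by move=> ST; apply: subset_bigcup => a _; exact: image_subset. Qed.

Lemma act_setU A S T :
  act_set act A (S `|` T) = act_set act A S `|` act_set act A T.
Proof.
by rewrite /act_set -bigcupU; apply: eq_bigcupr => a _; rewrite image_setU.
Qed.

Lemma act_set_bigcup A (S : (set X)^nat) :
  act_set act A (\bigcup_n S n) = \bigcup_n act_set act A (S n).
Proof.
apply/seteqP; split => [_ [a Aa [x [n _ Sx] <-]]|_ [n _ [a Aa [x Sx <-]]]].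
  by exists n => //; exists a => //; exists x.
by exists a => //; exists x => //; exists n.
Qed.

Lemma act_set1 S : act_set act [set 1%g] S = S.
Proof.
rewrite /act_set bigcup_set1 act_imageE.
by apply/seteqP; split => x /=; rewrite invg1 (Gspace_act1 XG).
Qed.

Lemma act_set_prod A F S :
  act_set act (set_prod A F) S = act_set act A (act_set act F S).
Proof.
apply/seteqP; split => [_ [_ [a Aa [g Fg <-]] [x Sx <-]]|].
  exists a => //; exists (act g x); last by rewrite (Gspace_actM XG).
  by exists g => //; exists x.
move=> _ [a Aa [_ [g Fg [x Sx <-]] <-]].
exists (a * g)%g; first by exists a => //; exists g.
by exists x => //; rewrite (Gspace_actM XG).
Qed.

Lemma act_image_setI g S T : act g @` S `&` T =
  act g @` (S `&` act g @^-1` T).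
Proof.
apply/seteqP; split => [_ [[x Sx <-] Tx]|_ [x [Sx Tx] <-]]; first by exists x.
by split => //; exists x.
Qed.

Lemma act_set_image (G_abelian : forall x y : G, (x * y)%g = (y * x)%g) A g S :
  act_set act A (act g @` S) = act g @` act_set act A S.
Proof.
rewrite /act_set image_bigcup; apply: eq_bigcupr => a _.
rewrite !image_comp; apply: eq_imagel => x _ /=.
by rewrite -!(Gspace_actM XG) G_abelian.
Qed.

End Translates.

Lemma set_powSS (G : groupType) (A : set G) k :
  set_pow A k.+2 = set_prod A (set_pow A k.+1).
Proof. by []. Qed.

(** * The excess functional *)

Section Excess.
Context {G : groupType} {d : measure_display} {X : measurableType d}.
Context {R : realType} {mu : probability X R} {act : G -> X -> X}.
Hypothesis XG : is_Gspace mu act.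
Hypothesis G_countable : countable [set: G].
Variables (A : set G) (K : R).
Hypothesis K_ge0 : (0 <= K)%R.
Local Open Scope ring_scope.
Local Notation m := (real_measure mu).

Definition excess (S : set X) : R := m (act_set act A S) - K * m S.

Let mA S : measurable S -> measurable (act_set act A S).
Proof. exact: (measurable_act_set XG). Qed.

Lemma excess_set0 : excess set0 = 0.
Proof. by rewrite /excess act_set0 real_measure0 mulr0 subr0. Qed.

Lemma excess_ge S : measurable S -> - K <= excess S.
Proof.
move=> mS; have := real_measure_ge0 mu (act_set act A S).
have : K * m S <= K by rewrite ler_piMr// real_measure_le1.
rewrite /excess; lra.
Qed.

Lemma excess_submodular : submodular excess.
Proof.
move=> S T mS mT; have mST := measurableI _ _ mS mT.
have := real_measureUI mu _ _ (mA S mS) (mA T mT); rewrite -act_setU.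
have : m (act_set act A (S `&` T)) <= m (act_set act A S `&` act_set act A T).
  apply: le_real_measure; [exact: mA | by apply: measurableI; exact: mA |].
  by move=> x STx; split; apply: act_setS STx => y [].
have := congr1 ( *%R K) (real_measureUI mu _ _ mS mT).
rewrite /excess !mulrDr; lra.
Qed.

Lemma excess_lsc_increasing : lsc_increasing excess.
Proof.
move=> S c mS S_homo excess_le.
have cvgE : excess (S n) @[n --> \oo] --> excess (\bigcup_n S n).
  rewrite /excess act_set_bigcup; apply: cvgB; last first.
    by apply: cvgMr; exact: real_measure_cvg_increasing.
  apply: real_measure_cvg_increasing => [n|n p np]; first exact: mA.
  exact/act_setS/S_homo.
by apply: (cvgr_to_le cvgE); near=> n; exact: excess_le.
Unshelve. all: by end_near. Qed.

(** Only an inequality survives here, as A does not commute with decreasing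
    intersections: [A (\bigcap_n S n)] is contained in every [A (S n)]. *)
Lemma excess_lsc_decreasing : lsc_decreasing excess.
Proof.
move=> S c mS S_homo excess_le; pose L := \bigcap_n S n.
have mL : measurable L by exact: bigcapT_measurable.
have cvgE : c + K * m (S n) @[n --> \oo] --> c + K * m L.
  apply: cvgD; first exact: cvg_cst.
  by apply: cvgMr; exact: real_measure_cvg_decreasing.
rewrite lerBlDr; apply: (cvgr_to_ge cvgE); near=> n.
apply: (@le_trans _ _ (m (act_set act A (S n)))); last first.
  by have := excess_le n; rewrite /excess lerBlDr.
by apply: le_real_measure; [exact: mA..|apply: act_setS => x; exact].
Unshelve. all: by end_near. Qed.

Lemma excess_translate (G_abelian : forall x y : G, (x * y)%g = (y * x)%g) g S :
  measurable S -> excess (act g @` S) = excess S.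
Proof.
move=> mS; rewrite /excess (act_set_image XG)// /real_measure.
by rewrite !(measure_act_image XG)//; exact: mA.
Qed.

(** * Petridis' argument for a minimizer of the excess *)

Section Minimizer.
Hypothesis G_abelian : forall x y : G, (x * y)%g = (y * x)%g.
Variable S : set X.
Hypothesis mS : measurable S.
Hypothesis S_min : forall S', measurable S' -> S' `<=` S -> excess S <= excess S'.

(** A translate of a minimizer is a minimizer over its own subsets, so
    intersecting it with [Y] cannot lower its excess; by submodularity, adding
    it to [Y] cannot raise the excess of [Y]. *)
Lemma excess_setU_translate g Y : measurable Y ->
  excess (act g @` S `|` Y) <= excess Y.
Proof.
move=> mY; have mgS := measurable_act_image XG g _ mS.
have := excess_submodular _ _ mgS mY; rewrite act_image_setI.
have mS' : measurable (S `&` act g @^-1` Y).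
  apply: measurableI => //; rewrite -[_ @^-1` _]setTI.
  exact: (Gspace_measurable XG).
rewrite !excess_translate//.
have : excess S <= excess (S `&` act g @^-1` Y) by apply: S_min => // x [].
lra.
Qed.

(** The translates are added in the order given by an injection of [G] into
    [nat]; passing to infinite [F] costs nothing since no error accumulates. *)
Lemma excess_act_set_le0 (F : set G) : excess (act_set act F S) <= 0.
Proof.
have /countable_injP[f f_inj] := G_countable.
pose Fn n := F `&` [set g | (f g < n)%N].
have -> : act_set act F S = \bigcup_n act_set act (Fn n) S.
  rewrite /act_set -bigcup_bigcup; congr (\bigcup_(_ in _) _).
  apply/seteqP; split => [g Fg|g [n _ []]//].
  by exists (f g).+1 => //; split => //=.
apply: excess_lsc_increasing => [n|n p np|n].
- exact: (measurable_act_set XG).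
- by apply: bigcup_subset => g [Fg gn]; split => //; exact: leq_trans gn np.
elim: n => [|n IHn].
  by rewrite /Fn (_ : _ `&` _ = set0) ?/act_set ?bigcup_set0 ?excess_set0//;
    apply/seteqP; split => // g [].
have [[g [Fg gn]]|no_g] := pselect (exists g, F g /\ f g = n).
  have -> : Fn n.+1 = g |` Fn n.
    apply/seteqP; split => [h [Fh]|h [->|[Fh hn]]] /=.
    - rewrite ltnS leq_eqVlt => /orP[/eqP hn|hn]; last by right.
      by left; apply: f_inj; rewrite ?inE// gn.
    - by split => //=; rewrite gn.
    - by split => //=; exact: ltnW.
  rewrite /act_set bigcup_setU1; apply: le_trans IHn.
  by apply: excess_setU_translate; exact: (measurable_act_set XG).
suff -> : Fn n.+1 = Fn n by [].
apply/seteqP; split => h [Fh /= hn]; split => //=; last exact: ltnW.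
move: hn; rewrite ltnS leq_eqVlt => /orP[/eqP hn|//].
by exfalso; apply: no_g; exists h.
Qed.

Lemma real_measure_act_set_pow k :
  m (act_set act (set_pow A k.+1) S) <= K ^+ k.+1 * m S.
Proof.
elim: k => [|k IHk].
  have := excess_act_set_le0 [set 1%g].
  by rewrite (act_set1 XG) /excess subr_le0 expr1.
have := excess_act_set_le0 (set_pow A k.+1).
rewrite /excess subr_le0 set_powSS (act_set_prod XG) => /le_trans; apply.
by rewrite exprS -mulrA ler_wpM2l.
Qed.

End Minimizer.

(** A minimizer over the subsets of [B] is null only if the minimum is 0, and
    then [B] itself is a minimizer. *)
Lemma excess_minimizer_gt0 (B : set X) :
  measurable B -> 0 < m B -> excess B = 0 ->
  exists S, [/\ measurable S, S `<=` B, 0 < m S &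
    forall S', measurable S' -> S' `<=` S -> excess S <= excess S'].
Proof.
move=> mB B_gt0 B0.
have [S [mS SB S_min]] := submodular_minimizer _ _ _ mB excess_ge
  excess_submodular excess_lsc_increasing excess_lsc_decreasing.
have [S_gt0|S_le0] := ltP 0 (m S).
  by exists S; split => // S' mS' S'S; apply: S_min => //; exact: subset_trans SB.
have S_ge0 : 0 <= excess S.
  rewrite /excess (_ : m S = 0) ?mulr0 ?subr0 ?real_measure_ge0//.
  by apply/eqP; rewrite eq_le S_le0 real_measure_ge0.
exists B; split => // S' mS' S'B.
by rewrite B0; exact: (le_trans S_ge0 (S_min _ mS' S'B)).
Qed.

End Excess.

Theorem proposition1p3 (G : groupType)
  (G_abelian : forall x y : G, (x * y)%g = (y * x)%g)
  (G_countable : countable [set: G])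
  (d : measure_display) (X : measurableType d) (R : realType)
  (mu : probability X R) (act : G -> X -> X)
  (XG : is_Gspace mu act)
  (A : set G) (B : set X) (mB : measurable B) (B_gt0 : 0 < mu B)
  (k : nat) (k_ge1 : (1 <= k)%N) :
  magnification mu act (set_pow A k) B
    <= (mu (act_set act A B) / mu B) ^+ k.
Proof.
have mAct F S : measurable S -> measurable (act_set act F S).
  exact: (measurable_act_set XG).
have divE S T : measurable S -> measurable T -> (0 < real_measure mu T)%R ->
    mu S / mu T = (real_measure mu S / real_measure mu T)%:E.
  by move=> mS mT T0; rewrite !real_measureE// inver gt_eqF.
have mB_gt0 : (0 < real_measure mu B)%R by rewrite -lte_fin -real_measureE.
rewrite divE//; last exact: mAct.
set K := (_ / _)%R.
have K_ge0 : (0 <= K)%R by rewrite divr_ge0 ?real_measure_ge0.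
have excessB : excess (mu := mu) (act := act) A K B = 0%R.
  by rewrite /excess /K divfK ?subrr// gt_eqF.
have [S [mS SB S_gt0 S_min]] :=
  excess_minimizer_gt0 XG G_countable _ _ K_ge0 _ mB mB_gt0 excessB.
apply: (@le_trans _ _ (mu (act_set act (set_pow A k) S) / mu S)).
  apply: ereal_inf_lbound; exists S => //.
  by split => //; rewrite real_measureE// lte_fin.
rewrite divE//; last exact: mAct.
rewrite -EFin_expe lee_fin ler_pdivrMr//.
case: k k_ge1 => // k _.
exact: (real_measure_act_set_pow XG G_countable _ _ K_ge0 G_abelian _ mS S_min).
Qed.
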